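(* Let $\Omega\subset\mathbb{R}^n$ be a bounded open set, $N\in\mathbb{N}$, and $u^c,u^\eta\in L^2(\Omega;\mathbb{R}^N)$. Let $\mathcal{R}:L^2(\Omega)\to[0,\infty]$ be convex and lower semicontinuous on $L^2(\Omega)$, vanish exactly on the constant functions, and have a domain $\{u\in L^2(\Omega):\mathcal{R}(u)<\infty\}$ that is dense in $L^2(\Omega)$. Suppose that $$\sum_{j=1}^N\mathcal{R}(u^c_j)<\sum_{j=1}^N\mathcal{R}(u^\eta_j)$$ and $$\|u^\eta-u^c\|^2_{L^2(\Omega;\mathbb{R}^N)}<\Bigl\|\frac{1}{|\Omega|}\int_\Omega u^\eta\,\mathrm{d}x-u^c\Bigr\|^2_{L^2(\Omega;\mathbb{R}^N)}.$$ For $\alpha\in(0,\infty)$ and $j\in\{1,\dots,N\}$ let $\mathcal{J}_{\alpha,j}(u)=\|u-u_j^\eta\|^2_{L^2(\Omega)}+\alpha\mathcal{R}(u)$ for $u\in L^2(\Omega)$, let $K_{\alpha,j}=\operatorname{arg\,min}_{u\in L^2(\Omega)}\mathcal{J}_{\alpha,j}(u)$, $K_\alpha=K_{\alpha,1}\times\dots\times K_{\alpha,N}$, and $$\mathcal{I}:(0,\infty)\to[0,\infty),\qquad \mathcal{I}(\alpha)=\inf_{w\in K_\alpha}\|w-u^c\|^2_{L^2(\Omega;\mathbb{R}^N)}.$$ Then the problem of minimizing $\mathcal{I}$ over $(0,\infty)$ admits a solution $\bar\alpha\in(0,\infty)$.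
   Context: Norm convention: $\|v\|^2_{L^2(\Omega;\mathbb{R}^N)}=\sum_{j=1}^N\|v_j\|^2_{L^2(\Omega)}$. The mean value $\frac{1}{|\Omega|}\int_\Omega u^\eta\,\mathrm{d}x\in\mathbb{R}^N$ is taken componentwise and regarded as a constant function on $\Omega$. *)

(* Defs.v *)
From HB Require Import structures.
From mathcomp Require Import all_boot all_order all_algebra.
From mathcomp Require Import all_classical all_reals all_analysis measurable_realfun.

Set Implicit Arguments.
Unset Strict Implicit.
Unset Printing Implicit Defensive.
Import Order.TTheory GRing.Theory Num.Theory.
Import numFieldNormedType.Exports.

Local Open Scope classical_set_scope.
Local Open Scope ring_scope.

Definition rV_display : measure_display -> measure_display.
Proof. exact. Qed.

Section measurable_rV.
Context d (T : measurableType d) (n : nat).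

Let coord (i : 'I_n) (x : 'rV[T]_n) : T := x ord0 i.

Let rV_set0 : g_sigma_preimage coord set0.
Proof. exact: sigma_algebra0. Qed.

Let rV_setC A : g_sigma_preimage coord A -> g_sigma_preimage coord (~` A).
Proof. exact: sigma_algebraC. Qed.

Let rV_bigcup (F : (set 'rV[T]_n)^nat) :
  (forall i, g_sigma_preimage coord (F i)) ->
  g_sigma_preimage coord (\bigcup_i (F i)).
Proof. exact: sigma_algebra_bigcup. Qed.

(* The product sigma-algebra on row vectors. For [T := R] it is the Borel
   sigma-algebra of R^n; [measurable_open_rV] below is one inclusion. *)
HB.instance Definition _ := @isMeasurable.Build (rV_display d)
  'rV[T]_n (g_sigma_preimage coord) rV_set0 rV_setC rV_bigcup.

Lemma measurable_coord (i : 'I_n) :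
  measurable_fun [set: 'rV[T]_n] (fun x : 'rV[T]_n => x ord0 i).
Proof.
move=> _ Y mY; rewrite setTI; apply: sub_sigma_algebra => /=.
rewrite -bigcup_seq/=; exists i => /=; first by rewrite mem_index_enum.
by exists Y => //; rewrite setTI.
Qed.

Lemma measurable_fun_rVP d1 (T1 : measurableType d1) (f : T1 -> 'rV[T]_n) :
  (forall i, measurable_fun setT (fun t => f t ord0 i)) ->
  measurable_fun setT f.
Proof.
move=> mf _ A mA; rewrite setTI.
suff: g_sigma_preimage coord `<=` [set B | measurable (f @^-1` B)] by exact.
apply: smallest_sub.
  split => /=.
  - by rewrite preimage_set0.
  - by move=> B mB; rewrite setTD preimage_setC; exact: measurableC.
  - by move=> F mF; rewrite preimage_bigcup; exact: bigcup_measurable.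
rewrite -bigcup_seq => B [i _ [C mC <-]] /=.
by rewrite setTI -[X in measurable X]setTI; exact: mf.
Qed.

End measurable_rV.

Section lebesgue_rV.
Context (R : realType).

Definition consrV n (p : measurableTypeR R * 'rV[R]_n) : 'rV[R]_n.+1 :=
  \row_i (if unlift ord0 i is Some j then p.2 ord0 j else p.1).

Lemma measurable_consrV n : measurable_fun setT (@consrV n).
Proof.
apply: measurable_fun_rVP => i.
have [j ->|->] := unliftP ord0 i.
  rewrite (_ : (fun _ => _) = (fun x : 'rV[R]_n => x ord0 j) \o snd).
    by apply: measurableT_comp; [exact: measurable_coord|exact: measurable_snd].
  by apply/funext => p; rewrite mxE liftK.
rewrite (_ : (fun _ => _) = fst); first exact: measurable_fst.
by apply/funext => p; rewrite mxE unlift_none.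
Qed.

Section cons_measure.
Variables (n : nat) (m : {measure set 'rV[R]_n -> \bar R}).

Definition cons_measure : set 'rV[R]_n.+1 -> \bar R :=
  pushforward (lebesgue_measure \x^ m)%E (@consrV n).

Let cons_measure0 : cons_measure set0 = 0%E.
Proof. by rewrite /cons_measure /pushforward preimage_set0 measure0. Qed.

Let cons_measure_ge0 A : (0 <= cons_measure A)%E.
Proof. by rewrite /cons_measure /pushforward measure_ge0. Qed.

Let cons_measure_sigma_additive : semi_sigma_additive cons_measure.
Proof.
move=> F mF tF mUF.
exact: (@measure_semi_sigma_additive _ _ _
  (measure_function_pushforward__canonical__measure_function_Measure
    (lebesgue_measure \x^ m)%E (@measurable_consrV n)) F mF tF mUF).
Qed.

HB.instance Definition _ := isMeasure.Build _ _ _ cons_measure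
  cons_measure0 cons_measure_ge0 cons_measure_sigma_additive.

End cons_measure.

(* n-dimensional Lebesgue measure, as the n-fold product of [lebesgue_measure];
   [lebesgue_rV_box] gives its value on products of measurable sets. *)
Fixpoint lebesgue_rV (n : nat) : {measure set 'rV[R]_n -> \bar R} :=
  match n with
  | 0 => \d_(0 : 'rV[R]_0)
  | n'.+1 => cons_measure (lebesgue_rV n')
  end.

Lemma measurable_box n (A : 'I_n -> set R) :
  (forall i, measurable (A i)) ->
  measurable [set x : 'rV[R]_n | forall i, A i (x ord0 i)].
Proof.
move=> mA; rewrite (_ : [set x | _] = \bigcap_(i in [set: 'I_n])
    ((fun x : 'rV[R]_n => x ord0 i) @^-1` A i)); last first.
  by apply/seteqP; split=> x /= Ax i; [move=> _|]; exact: Ax.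
apply: fin_bigcap_measurable => // i _; rewrite -[X in measurable X]setTI.
exact: (@measurable_coord _ R n i measurableT _ (mA i)).
Qed.

Lemma lebesgue_rV_box n (A : 'I_n -> set R) :
  (forall i, measurable (A i)) ->
  lebesgue_rV n [set x : 'rV[R]_n | forall i, A i (x ord0 i)] =
  (\prod_(i < n) lebesgue_measure (A i))%E.
Proof.
elim: n A => [|n IHn] A mA.
  by rewrite big_ord0 /= diracE mem_set//= => -[].
rewrite big_ord_recl/= /cons_measure /pushforward.
rewrite (_ : _ @^-1` _ = A ord0 `*`
    [set x : 'rV[R]_n | forall i, A (lift ord0 i) (x ord0 i)]); last first.
  apply/seteqP; split=> [[t x] /= Ax|[t x] /= [At Ax] i].
    split=> [|i]; first by have := Ax ord0; rewrite mxE unlift_none.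
    by have := Ax (lift ord0 i); rewrite mxE liftK.
  by have [j ->|->] := unliftP ord0 i; rewrite mxE ?liftK ?unlift_none//; exact: Ax.
have mB := measurable_box (fun i : 'I_n => mA (lift ord0 i)).
have mA0 : @measurable _ (measurableTypeR R) (A ord0) by exact: mA.
apply: (etrans (product_measure2E _ _ mA0 mB)); congr (_ * _)%E.
exact: (IHn _ (fun i => mA (lift ord0 i))).
Qed.

Lemma measurable_open_rV n (U : set 'rV[R]_n) : open U -> measurable U.
Proof.
move=> oU.
pose B (q : 'rV[rat]_n * rat) : set 'rV[R]_n :=
  [set x : 'rV[R]_n | forall i, ball (ratr (q.1 ord0 i) : R) (ratr q.2) (x ord0 i)].
rewrite (_ : U = \bigcup_(q in [set q | B q `<=` U]) B q); last first.
  apply/seteqP; split=> [x Ux|x [q qU]]; last exact: qU.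
  have /nbhs_ballP[e /= e0 xeU] : nbhs x U by exact: open_nbhs_nbhs.
  have /rat_in_itvoo[r /[!in_itv]/= /andP[r0 re]] : 0 < e / 2 by rewrite divr_gt0.
  have qx i : {q : rat | ratr q \in `]x ord0 i - ratr r, x ord0 i + ratr r[}.
    by apply/cid/rat_in_itvoo; rewrite ltrD2l (lt_trans _ r0)// oppr_lt0.
  exists (\row_i sval (qx i), r) => [y By|i] /=; last first.
    rewrite mxE; case: (qx i) => /= q; rewrite in_itv/= => /andP[xq qx'].
    by rewrite /ball/= ltr_distlC; apply/andP; split; [rewrite ltrBlDr|rewrite -ltrBlDr].
  apply: xeU; split => // k i; rewrite (ord1 k).
  have := By i; rewrite /= mxE; case: (qx i) => /= q.
  rewrite in_itv/= => /andP[xq qx'] qy.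
  rewrite /ball/= in qy *.
  rewrite (le_lt_trans (ler_distD (ratr q) _ _))// (splitr e) ltrD//.
    by rewrite (lt_trans _ re)// ltr_distlC xq.
  exact: lt_trans qy re.
rewrite bigcup_mkcond; apply: countable_bigcupT_measurable => // q.
case: ifPn => // _; apply: (@measurable_box n (fun i => ball _ _)) => i.
exact: measurable_ball.
Qed.

Lemma lebesgue_rV_bounded n (D : set 'rV[R]_n) :
  measurable D -> bounded_set D -> (lebesgue_rV n D < +oo)%E.
Proof.
move=> mD /pinfty_ex_gt0[M M0 /= DM].
have mB : measurable [set x : 'rV[R]_n | forall i, `[- M, M]%classic (x ord0 i)].
  by apply: (@measurable_box n (fun=> `[- M, M]%classic)).
apply: (@le_lt_trans _ _ (lebesgue_rV n
    [set x : 'rV[R]_n | forall i, `[- M, M]%classic (x ord0 i)])).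
  apply: le_measure; rewrite ?inE// => x Dx i /=.
  have {}Dx : `|x| <= M by exact: DM Dx.
  rewrite in_itv/= -ler_norml (le_trans _ Dx)//.
  rewrite (_ : `|x| = mx_norm x)// mx_normrE.
  exact: (le_bigmax _ (fun ij : 'I_1 * 'I_n => `|x ij.1 ij.2|) (ord0, i)).
rewrite (@lebesgue_rV_box n (fun=> `[- M, M]%classic))//.
suff : (\prod_(i < n) lebesgue_measure `[(- M)%R, M])%E \is a fin_num.
  by rewrite fin_numElt => /andP[].
elim/big_ind : _ => // [x y|i _]; first exact: fin_numM.
by rewrite lebesgue_measure_itv; case: ifP.
Qed.

End lebesgue_rV.

Section Lp_topology.
Context d (T : measurableType d) (R : realType).
Variables (mu : {measure set T -> \bar R}) (p : \bar R) (p1 : (1 <= p)%E).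
Local Notation Lp := (LfunType mu p1).

Definition Lp_ball (u : Lp) (e : R) : set Lp :=
  [set v | ('N[mu]_p[EFin \o (u - v : Lp)%R] < e%:E)%E].

Let Lp_ball_center u (e : R) : 0 < e -> Lp_ball u e u.
Proof.
move=> e0; rewrite /Lp_ball /mkset subrr.
by rewrite (_ : _ \o _ = cst 0%E)// Lnorm0 ?lte_fin// gt_eqF// (lt_le_trans _ p1).
Qed.

Let Lp_ball_sym u v (e : R) : Lp_ball u e v -> Lp_ball v e u.
Proof.
rewrite /Lp_ball /mkset -(finite_norm_fine (u - v)) -(finite_norm_fine (v - u)).
have -> : v - u = - (u - v) by rewrite opprB.
by rewrite LnormrN.
Qed.

Let Lp_ball_triangle u v w (e1 e2 : R) :
  Lp_ball u e1 v -> Lp_ball v e2 w -> Lp_ball u (e1 + e2) w.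
Proof.
rewrite /Lp_ball /mkset => uv vw.
have -> : u - w = (u - v) + (v - w) by rewrite addrA subrK.
rewrite -(finite_norm_fine (u - v)) lte_fin in uv.
rewrite -(finite_norm_fine (v - w)) lte_fin in vw.
rewrite -(finite_norm_fine ((u - v) + (v - w))) lte_fin.
apply: le_lt_trans (ltrD uv vw).
exact: (ler_LnormD (u - v) (v - w)).
Qed.

(* The topology of the L^p seminorm on the type of p-integrable functions,
   whose quotient by a.e. equality is the usual L^p space. *)
HB.instance Definition _ := hasNbhs.Build Lp (nbhs_ (entourage_ Lp_ball)).
HB.instance Definition _ := @Nbhs_isPseudoMetric.Build R Lp
  (entourage_ Lp_ball) erefl Lp_ball Lp_ball_center Lp_ball_sym
  Lp_ball_triangle erefl.

End Lp_topology.

Section L2.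
Local Open Scope ereal_scope.
Context (R : realType) (n : nat) (Omega : set 'rV[R]_n).
Hypothesis oOmega : open Omega.

Definition lebesgue_on : {measure set 'rV[R]_n -> \bar R} :=
  mrestr (lebesgue_rV R n) (measurable_open_rV oOmega).

(* Elements are functions on R^n; they matter only up to equality almost
   everywhere for [lebesgue_on], that is, almost everywhere in Omega. *)
Definition L2 := LfunType lebesgue_on (lee1n 2).

Definition normL2sq (f : 'rV[R]_n -> R) : \bar R :=
  'N[lebesgue_on]_2%:E[EFin \o f] ^+ 2.

Definition normL2sqv N (f : 'I_N -> 'rV[R]_n -> R) : \bar R :=
  \sum_(j < N) normL2sq (f j).

(* For bounded Omega the measure of Omega is finite ([lebesgue_rV_bounded]), so
   neither [fine] nor the real-valued integral truncates an infinite value. *)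
Definition mean (f : 'rV[R]_n -> R) : R :=
  (\int[lebesgue_rV R n]_(x in Omega) f x / fine (lebesgue_rV R n Omega))%R.

(* With the library convention [0 * +oo = 0], the endpoints t = 0 and t = 1
   impose nothing. *)
Definition econvex (E : lmodType R) (f : E -> \bar R) :=
  forall (t : R) (u v : E), (0 <= t <= 1)%R ->
    f (t *: u + (1 - t) *: v)%R <= t%:E * f u + (1 - t)%:E * f v.

Context (N : nat) (Reg : L2 -> \bar R) (uc ueta : 'I_N -> L2).

Definition functional_J (a : R) (j : 'I_N) (u : L2) : \bar R :=
  normL2sq (u - ueta j)%R + a%:E * Reg u.

Definition argmin_K (a : R) (j : 'I_N) : set L2 :=
  [set u | forall v, functional_J a j u <= functional_J a j v].

(* Valued in [\bar R], so that the infimum over an empty set is [+oo]. *)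
Definition cost_I (a : R) : \bar R :=
  ereal_inf [set normL2sqv (fun j => w j - uc j)%R |
    w in [set w : 'I_N -> L2 | forall j, argmin_K a j (w j)]].

End L2.

(* Main.v *)
Require Import Defs.
From mathcomp Require Import all_boot all_order all_algebra.
From mathcomp Require Import all_classical all_reals all_analysis.
From mathcomp Require Import measurable_realfun ring lra.

(** Write q for the squared seminorm of L^2, u_a for a minimizer of
    q (u - eta) + a * Reg u, r_a for Reg u_a, and phi_a for q (u_a - eta).

    Because q is quadratic and Reg is convex, the functional grows at least
    quadratically away from a minimizer ([min_strong]):
      phi_a + a * r_a + q (v - u_a) <= q (v - eta) + a * Reg v   for every v.
    This inequality is behind everything else. It gives uniqueness up to
    equality almost everywhere ([min_unique]), so the cost of a parameter a is
    the single number I a = \sum_j q (u_a,j - uc_j). Likewise, two nearly optimal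
    points are close to each other, since their midpoint is not better than
    optimal. So minimizing sequences are Cauchy, and minimizers exist because L^2
    is complete ([L2_complete]) and Reg is lower semicontinuous ([min_exists]).

    Comparing two parameters gives 2 q (u_b - u_a) <= (b - a) (r_a - r_b), hence
    u_a depends continuously on a ([path_continuous]). Comparing with points of
    the dense domain of Reg gives u_a -> eta as a -> 0 ([path_cvg_at0]). For
    a <= b the strong inequality also gives q (u_b - u_a) <= phi_b - phi_a; since
    phi is bounded, u_a is Cauchy as a -> +oo, and as r_a = O(1/a) its limit is a
    zero of Reg, namely the one nearest to eta ([path_cvg_pinfty]). The zeros of
    Reg are the constants, and the constant nearest to eta is its mean, an
    orthogonal projection ([line_projection]).

    So I is continuous on ]0, +oo[, it tends to the squared distance of ueta to
    uc at 0 and to that of the means of ueta to uc at +oo; the second limit is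
    larger, by hypothesis. It remains to find one parameter whose cost is below
    the limit at 0. Taking v = uc in the strong inequality and summing over j,
      I a <= \sum_j q (ueta_j - uc_j) + a * (\sum_j Reg uc_j - \sum_j r_a,j),
    and for small a the last bracket is negative: \sum_j Reg uc_j is smaller than
    \sum_j Reg ueta_j, and u_a,j -> ueta_j with Reg lower semicontinuous. Hence
    the infimum of I is an infimum over a compact interval, where it is attained
    ([exists_min_pos], [exists_optimal_parameter]). *)

Import Order.TTheory GRing.Theory Num.Theory.
Import numFieldNormedType.Exports.
Local Open Scope classical_set_scope.
Local Open Scope ring_scope.

Set Implicit Arguments.
Unset Strict Implicit.
Unset Printing Implicit Defensive.

(** * Semi-inner products *)

(** Degenerate directions are allowed, because square-integrable functions that
    agree almost everywhere are not identified. *)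
Record semi_inner (R : realType) (H : lmodType R) := SemiInner {
  inner :> H -> H -> R ;
  innerC : forall u v, inner u v = inner v u ;
  innerDl : forall u v w, inner (u + v) w = inner u w + inner v w ;
  innerZl : forall a u v, inner (a *: u) v = a * inner u v ;
  inner_ge0 : forall u, 0 <= inner u u }.

Section semi_inner_theory.
Context (R : realType) (H : lmodType R) (ip : semi_inner H).

Definition sqn (u : H) : R := ip u u.

Definition sqn_complete := forall u : nat -> H,
  (forall e : R, 0 < e ->
     exists K, forall m k, (K <= m)%N -> (K <= k)%N -> sqn (u m - u k) < e) ->
  exists l, sqn (u k - l) @[k --> \oo] --> 0.

(** Lower semicontinuity for the topology that [sqn] induces, spelled out so that
    a space needs no topology of its own to state it. *)
Definition sqn_lsc (f : H -> \bar R) := forall u (b : R), (b%:E < f u)%E ->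
  exists2 e : R, 0 < e & forall v, sqn (v - u) < e -> (b%:E < f v)%E.

Lemma sqn_ge0 u : 0 <= sqn u. Proof. exact: inner_ge0. Qed.

Lemma innerDr u v w : ip u (v + w) = ip u v + ip u w.
Proof. by rewrite innerC innerDl !(innerC _ u). Qed.

Lemma innerZr a u v : ip u (a *: v) = a * ip u v.
Proof. by rewrite innerC innerZl innerC. Qed.

Lemma innerNl u v : ip (- u) v = - ip u v.
Proof. by rewrite -scaleN1r innerZl mulN1r. Qed.

Lemma innerNr u v : ip u (- v) = - ip u v.
Proof. by rewrite innerC innerNl innerC. Qed.

Definition innerE := (innerDl, innerDr, innerNl, innerNr, innerZl, innerZr).

Lemma sqn0 : sqn 0 = 0.
Proof. by rewrite /sqn -(scale0r (0 : H)) innerZl mul0r. Qed.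

Lemma sqnZ a u : sqn (a *: u) = a ^+ 2 * sqn u.
Proof. by rewrite /sqn !innerE; ring. Qed.

Lemma sqnN u : sqn (- u) = sqn u.
Proof. by rewrite /sqn !innerE; ring. Qed.

Lemma sqnBC u v : sqn (u - v) = sqn (v - u).
Proof. by rewrite -sqnN opprB. Qed.

Lemma sqnD u v : sqn (u + v) = sqn u + 2 * ip u v + sqn v.
Proof. by rewrite /sqn !innerE (innerC _ v u); ring. Qed.

Lemma sqn_le_double u v w : sqn (u - w) <= 2 * sqn (u - v) + 2 * sqn (v - w).
Proof.
have := sqn_ge0 ((u - v) - (v - w)); have -> : u - w = (u - v) + (v - w).
  by rewrite addrA subrK.
move: (u - v) (v - w) => a b.
by rewrite !sqnD sqnN innerNr; lra.
Qed.

(** The defect [t * (1 - t) * sqn (u - v)] from convexity is what makes the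
    Tikhonov functional strongly convex. *)
Lemma sqn_convex (t : R) u v w :
  sqn (t *: u + (1 - t) *: v - w) =
  t * sqn (u - w) + (1 - t) * sqn (v - w) - t * (1 - t) * sqn (u - v).
Proof.
rewrite /sqn !innerE (innerC _ v u) (innerC _ w u) (innerC _ w v); ring.
Qed.

(** The trinomial [t |-> sqn (u + t *: v)] is nonnegative. When [sqn v] vanishes it
    is affine, which forces [ip u v = 0]. *)
Lemma cauchy_schwarz u v : ip u v ^+ 2 <= sqn u * sqn v.
Proof.
have h t : 0 <= sqn u + 2 * t * ip u v + t ^+ 2 * sqn v.
  have := sqn_ge0 (u + t *: v); rewrite sqnD sqnZ innerZr; lra.
have [v0|v0] := eqVneq (sqn v) 0.
  rewrite v0 mulr0; case: (eqVneq (ip u v) 0) => [->|i0]; first by rewrite expr0n.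
  have := h (- (sqn u + 1) / (2 * ip u v)).
  rewrite v0 mulr0 addr0.
  have -> : 2 * (- (sqn u + 1) / (2 * ip u v)) * ip u v = - (sqn u + 1) by field.
  by move=> ?; exfalso; lra.
have vp : 0 < sqn v by rewrite lt_neqAle eq_sym v0 sqn_ge0.
have := h (- ip u v / sqn v).
have -> : sqn u + 2 * (- ip u v / sqn v) * ip u v + (- ip u v / sqn v) ^+ 2 * sqn v
  = (sqn u * sqn v - ip u v ^+ 2) / sqn v by field.
by rewrite pmulr_lge0 ?invr_gt0// subr_ge0.
Qed.

(** Points at distance zero are interchangeable in every distance, by
    Cauchy-Schwarz. *)
Lemma sqn_eq0_dist u v w : sqn (u - v) = 0 -> sqn (u - w) = sqn (v - w).
Proof.
move=> uv0; have := cauchy_schwarz (u - v) (v - w).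
rewrite uv0 mul0r -[u - w](subrKA v) sqnD uv0.
rewrite le_eqVlt ltNge sqr_ge0 orbF sqrf_eq0 => /eqP ->; ring.
Qed.

(** In a degenerate direction [e] the inner product [ip e f] vanishes by
    Cauchy-Schwarz, so all points of the line are equally far from [f] and the
    value of the quotient by zero does not matter. *)
Lemma line_projection (e f : H) (c : R) :
  sqn ((ip e f / sqn e) *: e - f) <= sqn (c *: e - f).
Proof.
have expand t : sqn (t *: e - f) = t ^+ 2 * sqn e - 2 * t * ip e f + sqn f.
  by rewrite sqnD sqnZ sqnN innerNr innerZl; ring.
rewrite !expand.
have [e0|e0] := eqVneq (sqn e) 0.
  have := cauchy_schwarz e f; rewrite e0 mul0r.
  by rewrite le_eqVlt ltNge sqr_ge0 orbF sqrf_eq0 => /eqP ->; lra.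
have ep : 0 < sqn e by rewrite lt_neqAle eq_sym e0 sqn_ge0.
rewrite lerD2r -subr_ge0.
have -> : c ^+ 2 * sqn e - 2 * c * ip e f -
    ((ip e f / sqn e) ^+ 2 * sqn e - 2 * (ip e f / sqn e) * ip e f) =
    (c * sqn e - ip e f) ^+ 2 / sqn e by field.
by apply: divr_ge0; [exact: sqr_ge0|exact: sqn_ge0].
Qed.

Lemma sqn_cvg0 (T : Type) (F : set_system T) {FF : ProperFilter F}
    (f : T -> H) l :
  (forall e : R, 0 < e -> \forall t \near F, sqn (f t - l) < e) ->
  sqn (f t - l) @[t --> F] --> 0.
Proof.
move=> fl; apply/cvgr0Pnorm_lt => e /fl; apply: filterS => t.
by rewrite ger0_norm ?sqn_ge0.
Qed.

Lemma sqn_cvg (T : Type) (F : set_system T) {FF : ProperFilter F}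
    (f : T -> H) l c : sqn (f t - l) @[t --> F] --> 0 ->
  sqn (f t - c) @[t --> F] --> sqn (l - c).
Proof.
move=> fl.
have -> : (fun t => sqn (f t - c)) =
    (fun t => sqn (f t - l) + 2 * ip (f t - l) (l - c) + sqn (l - c)).
  by apply/funext => t; rewrite -sqnD addrA subrK.
rewrite -[X in _ --> X]add0r -[X in _ --> X + _]addr0.
apply: cvgD; last exact: cvg_cst.
apply: cvgD => //; rewrite -[X in _ --> X](mulr0 2); apply: cvgM; first exact: cvg_cst.
apply/cvgr0Pnorm_le => e e0.
move/cvgr0Pnorm_lt : fl => /(_ (e ^+ 2 / (sqn (l - c) + 1))) fl.
have lc1 : 0 < sqn (l - c) + 1 by rewrite ltr_wpDl// sqn_ge0.
have := fl (divr_gt0 (exprn_gt0 2 e0) lc1).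
apply: filterS => t; rewrite ger0_norm ?sqn_ge0// ltr_pdivlMr// => ht.
have := cauchy_schwarz (f t - l) (l - c) => cs.
rewrite -(@ler_pXn2r _ 2) ?nnegrE ?(ltW e0)// -normrX ger0_norm ?sqr_ge0//.
apply: (le_trans cs); apply: le_trans (ltW ht).
by rewrite ler_wpM2l ?sqn_ge0//; lra.
Qed.

(** How lower semicontinuity enters: an upper bound on [Reg] along a family
    survives in the limit, even if the bound varies. *)
Lemma sqn_lsc_le (T : Type) (F : set_system T) {FF : ProperFilter F}
    (Reg : H -> \bar R) (f : T -> H) l (x : T -> R) (y : R) :
  sqn_lsc Reg -> sqn (f t - l) @[t --> F] --> 0 -> x t @[t --> F] --> y ->
  (\forall t \near F, Reg (f t) <= (x t)%:E)%E -> (Reg l <= y%:E)%E.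
Proof.
move=> lsc fl xy fx; rewrite leNgt; apply/negP => yl.
have [b yb bl] : exists2 b : R, y < b & (b%:E < Reg l)%E.
  move: yl; case: (Reg l) => [r||]; last by rewrite ltNge leNye.
    by rewrite lte_fin => yr; exists ((y + r) / 2); rewrite ?lte_fin; lra.
  by move=> _; exists (y + 1); [rewrite ltrDl|exact: ltry].
have [e e0 he] := lsc _ _ bl.
have F1 : \forall t \near F, sqn (f t - l) < e by apply: cvgr_lt fl _ e0.
have F2 : \forall t \near F, x t < b by apply: cvgr_lt xy _ yb.
have [t [/he h1 [h2 h3]]] := filter_ex (filterI F1 (filterI F2 fx)).
by have := lt_le_trans h1 h3; rewrite lte_fin ltNge (ltW h2).
Qed.

End semi_inner_theory.

(** * Tikhonov regularization and its dependence on the parameter *)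

Section tikhonov.
Context (R : realType) (H : lmodType R) (ip : semi_inner H).
Local Notation q := (sqn ip).
Context (Reg : H -> \bar R).
Hypothesis Reg_ge0 : forall u, (0 <= Reg u)%E.
Local Notation reg u := (fine (Reg u)).

Definition tikhonov (eta : H) (a : R) (u : H) : \bar R :=
  ((q (u - eta))%:E + a%:E * Reg u)%E.

Definition tikhonov_min (eta : H) (a : R) (u : H) :=
  forall v, (tikhonov eta a u <= tikhonov eta a v)%E.

Lemma regE u : (Reg u < +oo)%E -> (reg u)%:E = Reg u.
Proof. by move=> uoo; rewrite fineK// ge0_fin_numE. Qed.

Lemma reg_ge0 u : 0 <= reg u.
Proof. exact: fine_ge0. Qed.

Lemma tikhonovE eta a u : (Reg u < +oo)%E ->
  tikhonov eta a u = (q (u - eta) + a * reg u)%:E.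
Proof. by move=> uoo; rewrite /tikhonov -regE. Qed.

Hypothesis Reg_convex : econvex Reg.

(** The domain of [Reg] is convex, and there the values are real numbers, so that
    the estimates below are inequalities in [R]. *)
Lemma reg_convex (t : R) u v : 0 <= t <= 1 ->
  (Reg u < +oo)%E -> (Reg v < +oo)%E ->
  (Reg (t *: u + (1 - t) *: v) < +oo)%E /\
  reg (t *: u + (1 - t) *: v) <= t * reg u + (1 - t) * reg v.
Proof.
move=> t01 uoo voo; have := Reg_convex u v t01.
rewrite -(regE uoo) -(regE voo) -!EFinM -EFinD => le.
have moo := le_lt_trans le (ltry _); split => //.
by rewrite -lee_fin (regE moo).
Qed.

Section finite_point.
Context (v0 : H) (v0_fin : (Reg v0 < +oo)%E).

Lemma min_fin eta (a : R) u : 0 < a -> tikhonov_min eta a u -> (Reg u < +oo)%E.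
Proof.
move=> a0 /(_ v0); rewrite (tikhonovE _ _ v0_fin) => le.
move: le; rewrite /tikhonov ltey; case: eqVneq => // ->.
by rewrite gt0_muley ?lte_fin// addey// leye_eq.
Qed.

(** Compare [u] with [t *: v + (1 - t) *: u], divide by [t] and let [t] tend to 0:
    the convexity defect leaves the full term [q (v - u)]. Taking only the
    midpoint would leave half of it, which is too little for
    [exists_optimal_parameter]. *)
Lemma min_strong eta (a : R) u v : 0 < a -> tikhonov_min eta a u ->
  (Reg v < +oo)%E ->
  q (u - eta) + a * reg u + q (v - u) <= q (v - eta) + a * reg v.
Proof.
move=> a0 mu voo; have uoo := min_fin a0 mu.
have h t : 0 < t < 1 -> q (u - eta) + a * reg u + (1 - t) * q (v - u) <=
    q (v - eta) + a * reg v.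
  move=> /andP[t0 t1].
  have [|moo mle] := @reg_convex t v u _ voo uoo; first by rewrite !ltW.
  have := mu (t *: v + (1 - t) *: u).
  rewrite (tikhonovE _ _ moo) (tikhonovE _ _ uoo) lee_fin sqn_convex => le.
  rewrite -(ler_pM2l t0).
  have := ler_wpM2l (ltW a0) mle.
  lra.
have qp := sqn_ge0 ip (v - u).
apply/ler_addgt0Pr => e e0.
(* t is so small that t * q (v - u) <= e. *)
pose t := Num.min (1 / 2) (e / (q (v - u) + 1)).
have qp1 : 0 < q (v - u) + 1 by rewrite ltr_wpDl.
have t0 : 0 < t by rewrite lt_min divr_gt0//= divr_gt0.
have t1 : t < 1 by rewrite gt_min; apply/orP; left; lra.
have te : t * (q (v - u) + 1) <= e.
  by rewrite -ler_pdivlMr// ge_min lexx orbT.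
have := h t; rewrite t0 t1 => /(_ isT) le.
lra.
Qed.

(** Each minimizer beats the other by their squared distance. *)
Lemma min_unique eta (a : R) u v : 0 < a -> tikhonov_min eta a u ->
  tikhonov_min eta a v -> q (u - v) = 0.
Proof.
move=> a0 mu mv.
have h1 := min_strong a0 mu (min_fin a0 mv).
have h2 := min_strong a0 mv (min_fin a0 mu).
apply/eqP; rewrite eq_le sqn_ge0 andbT; move: h1 h2; rewrite (sqnBC ip v u); lra.
Qed.

Hypothesis Reg_lsc : sqn_lsc ip Reg.
Hypothesis complete : sqn_complete ip.

(** The direct method without weak compactness: by the parallelogram identity a
    minimizing sequence is Cauchy. *)
Lemma min_exists eta (a : R) : 0 < a -> exists u, tikhonov_min eta a u.
Proof.
move=> a0.
pose J u := q (u - eta) + a * reg u.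
pose S := [set J u | u in [set u | (Reg u < +oo)%E]].
have S_ge0 : lbound S 0.
  by move=> _ [u _ <-]; rewrite addr_ge0 ?sqn_ge0// mulr_ge0 ?reg_ge0// ltW.
have S0 : S !=set0 by exists (J v0), v0.
have hS : has_inf S by split => //; exists 0.
pose m := inf S.
have m_le u : (Reg u < +oo)%E -> m <= J u.
  by move=> uoo; apply: ge_inf; [exists 0|exists u].
have /choice[u hu] : forall k : nat, exists u, (Reg u < +oo)%E /\ J u < m + k.+1%:R^-1.
  move=> k.
  have [_ [u uoo <-] ltu] : exists2 x, S x & x < m + k.+1%:R^-1.
    by apply: inf_adherent.
  by exists u.
(* The midpoint of two nearly optimal points is not better than optimal. *)
have near_min v w (e : R) : (Reg v < +oo)%E -> (Reg w < +oo)%E ->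
    J v < m + e -> J w < m + e -> q (v - w) <= 4 * e.
  move=> voo woo ve we.
  have [|moo mle] := @reg_convex (1/2) v w _ voo woo; first by apply/andP; split; lra.
  have := m_le _ moo; rewrite /J sqn_convex => le.
  have := ler_wpM2l (ltW a0) mle.
  move: ve we; rewrite /J; lra.
have [|l ul] := complete (u := u).
  move=> e e0.
  have : \forall k \near \oo, k.+1%:R^-1 < e / 4.
    by apply: cvgr_lt (@cvg_harmonic R) _ _; rewrite divr_gt0.
  move=> [K _ hK]; exists K => i j Ki Kj.
  have invl k : (K <= k)%N -> J (u k) < m + K.+1%:R^-1.
    move=> Kk; apply: (lt_le_trans (hu k).2).
    by rewrite lerD2l lef_pV2 ?posrE// ler_nat.
  apply: (le_lt_trans (near_min _ _ _ (hu i).1 (hu j).1 (invl _ Ki) (invl _ Kj))).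
  have /= := hK K (leqnn K); move: (K.+1%:R^-1) => x; lra.
exists l => v.
have [voo|voo] := eqVneq (Reg v) +oo%E.
  by rewrite {2}/tikhonov voo gt0_muley ?lte_fin// addey// leey.
have {}voo : (Reg v < +oo)%E by rewrite ltey.
have ql : q (u k - eta) @[k --> \oo] --> q (l - eta) by exact: sqn_cvg ul.
(* The bound J (u k) < m + 1/(k+1), solved for Reg (u k), passes to the limit. *)
have le : (Reg l <= ((m - q (l - eta)) / a)%:E)%E.
  apply: (@sqn_lsc_le _ _ ip _ \oo _ Reg u l
    (fun k => (m + k.+1%:R^-1 - q (u k - eta)) / a)) => //.
    have mk : m + k.+1%:R^-1 @[k --> \oo] --> m.
      rewrite -[X in _ --> X]addr0.
      exact: cvgD (cvg_cst _) (@cvg_harmonic R).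
    exact: cvgM (cvgB mk ql) (cvg_cst _).
  near=> k; rewrite -(regE (hu k).1) lee_fin ler_pdivlMr//.
  have := (hu k).2; rewrite /J; move: (k.+1%:R^-1) => x; lra.
have loo := le_lt_trans le (ltry _).
rewrite (tikhonovE _ _ loo) (tikhonovE _ _ voo) lee_fin.
apply: le_trans (m_le _ voo).
move: le; rewrite -(regE loo) lee_fin ler_pdivlMr//; lra.
Unshelve. all: by end_near. Qed.


Section path.
Context (eta : H) (U : R -> H).
Hypothesis U_min : forall a : R, 0 < a -> tikhonov_min eta a (U a).

Lemma path_fin (a : R) : 0 < a -> (Reg (U a) < +oo)%E.
Proof. by move=> a0; exact: min_fin (U_min a0). Qed.

(** Sum of the strong inequalities at [a] and at [b], each tested with the other
    minimizer. *)
Lemma path_dist_le (a b : R) : 0 < a -> 0 < b ->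
  2 * q (U b - U a) <= (b - a) * (reg (U a) - reg (U b)).
Proof.
move=> a0 b0.
have := min_strong a0 (U_min a0) (path_fin b0).
have := min_strong b0 (U_min b0) (path_fin a0).
rewrite (sqnBC ip (U a)); lra.
Qed.

(** The penalty of the minimizer decreases with the parameter, so in the strong
    inequality at [a] the penalty terms can be dropped. This bounds distances by
    increments of a monotone function. *)
Lemma path_dist_le_fidelity (a b : R) : 0 < a -> a <= b ->
  q (U b - U a) <= q (U b - eta) - q (U a - eta).
Proof.
move=> a0; rewrite le_eqVlt => /predU1P[<-|ab]; first by rewrite !subrr (sqn0 ip).
have b0 := lt_trans a0 ab.
have rab : reg (U b) <= reg (U a).
  have := path_dist_le a0 b0; have := sqn_ge0 ip (U b - U a) => h1 h2.
  have : 0 <= (b - a) * (reg (U a) - reg (U b)) by lra.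
  by rewrite pmulr_rge0 ?subr_ge0// subr_gt0.
have := min_strong a0 (U_min a0) (path_fin b0).
have := ler_wpM2l (ltW a0) rab; lra.
Qed.

Lemma path_reg_le (a : R) v : 0 < a -> (Reg v < +oo)%E ->
  reg (U a) <= reg v + q (v - eta) / a.
Proof.
move=> a0 voo; have := min_strong a0 (U_min a0) voo.
have := sqn_ge0 ip (v - U a); have := sqn_ge0 ip (U a - eta) => h1 h2 h3.
rewrite -(ler_pM2l a0) mulrDr mulrCA divff ?gt_eqF// mulr1; lra.
Qed.

(** The right-hand side of [path_dist_le] is [O(b - a)], because penalties stay
    bounded for parameters away from 0. *)
Lemma path_continuous (a : R) : 0 < a -> q (U b - U a) @[b --> a] --> 0.
Proof.
move=> a0; apply: (@sqn_cvg0 _ _ ip _ (nbhs a)) => e e0.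
(* The bound of path_reg_le for parameters larger than a / 2. *)
pose M := reg v0 + 2 * q (v0 - eta) / a.
have q0 := sqn_ge0 ip (v0 - eta).
have M0 : 0 <= M by rewrite addr_ge0 ?reg_ge0// divr_ge0 ?mulr_ge0// ltW.
have M1 : 0 < M + 1 by lra.
have near_half : \forall b \near a, a / 2 < b.
  by apply: (@cvgr_gt _ _ (nbhs a) _ id a); [exact: cvg_id|lra].
have near_e : \forall b \near a, `|a - b| < e / (M + 1).
  by apply: (@cvgr_dist_lt _ _ _ (nbhs a) _ id a); [exact: cvg_id|exact: divr_gt0].
near=> b.
have ab : a / 2 < b by near: b.
have abe : `|a - b| < e / (M + 1) by near: b.
have b0 : 0 < b by lra.
have reg_le c : a / 2 < c -> reg (U c) <= M.
  move=> ac; have c0 : 0 < c by lra.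
  apply: (le_trans (path_reg_le c0 v0_fin)); rewrite lerD2l.
  rewrite ler_pdivrMr// mulrAC ler_pdivlMr//.
  by have := ler_wpM2l q0 (ltW ac); lra.
have ra : reg (U a) <= M by apply: reg_le; lra.
have rb := reg_le _ ab.
have := path_dist_le a0 b0; have := reg_ge0 (U a); have := reg_ge0 (U b) => rb0 ra0 le.
have : `|reg (U a) - reg (U b)| <= M by rewrite ler_norml; apply/andP; split; lra.
move=> /(ler_wpM2l (normr_ge0 (b - a))); rewrite -normrM => le2.
have := le_trans (ler_norm _) le2; move: abe; rewrite distrC ltr_pdivlMr//.
have := normr_ge0 (b - a); have := sqn_ge0 ip (U b - U a); lra.
Unshelve. all: by end_near. Qed.

(** A point [v] of the domain close to [eta] has finite penalty, which the factor
    [a] makes negligible. *)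
Lemma path_cvg_at0 :
  (forall e : R, 0 < e -> exists2 v, (Reg v < +oo)%E & q (v - eta) < e) ->
  q (U a - eta) @[a --> 0^'+] --> 0.
Proof.
move=> dense_dom; apply: sqn_cvg0 => e e0.
have [|v voo ve] := dense_dom (e / 2); first by lra.
near=> a.
have a0 : 0 < a by near: a; exact: nbhs_right_gt.
have ae : a < e / (2 * (reg v + 1)).
  near: a; apply: nbhs_right_lt; rewrite divr_gt0// mulr_gt0//.
  by rewrite ltr_wpDl// reg_ge0.
have := min_strong a0 (U_min a0) voo.
have r0 := reg_ge0 v.
move: ae; rewrite ltr_pdivlMr; last by lra.
have := mulr_ge0 (ltW a0) (reg_ge0 (U a)).
have := sqn_ge0 ip (v - U a); lra.
Unshelve. all: by end_near. Qed.

(** The increasing quantity [q (U a - eta)] is bounded by its value at the zero [p]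
    of [Reg], so its increments become small. *)
Lemma path_cauchy (p : H) : (Reg p = 0)%E -> forall e : R, 0 < e ->
  exists2 a0 : R, 0 < a0 &
    forall a b, a0 <= a -> a0 <= b -> q (U a - U b) < e.
Proof.
move=> p0 e e0; have poo : (Reg p < +oo)%E by rewrite p0.
pose S := [set q (U a - eta) | a in [set a | 0 < a]].
have S_le : ubound S (q (p - eta)).
  move=> _ [a /= a0 <-]; have := min_strong a0 (U_min a0) poo.
  rewrite p0/=; have := mulr_ge0 (ltW a0) (reg_ge0 (U a)).
  have := sqn_ge0 ip (p - U a); lra.
have hS : has_sup S.
  by split; [exists (q (U 1 - eta)), 1 => //=|exists (q (p - eta))].
have [_ [a0 /= a00 <-] lt_a0] := sup_adherent e0 hS.
have le_sup a : 0 < a -> q (U a - eta) <= sup S.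
  by move=> a1; apply: ub_le_sup; [exact: hS.2|exists a].
exists a0 => //.
have h a b : a0 <= a -> a <= b -> q (U b - U a) < e.
  move=> a0a ab; have a1 := lt_le_trans a00 a0a.
  have := path_dist_le_fidelity a1 ab; have := path_dist_le_fidelity a00 a0a.
  have := le_sup b (lt_le_trans a1 ab); have := sqn_ge0 ip (U a - U a0); lra.
move=> a b a0a a0b; have [ab|/ltW ba] := leP a b; last exact: h.
by rewrite sqnBC; exact: h.
Qed.

(** The limit [l] of the minimizers is a zero of [Reg] that is not farther from
    [eta] than [p]. If [l] and [p] were apart, their midpoint would be a closer
    zero. *)
Lemma path_cvg_pinfty (p : H) : (Reg p = 0)%E ->
  (forall v, (Reg v = 0)%E -> q (p - eta) <= q (v - eta)) ->
  q (U a - p) @[a --> +oo] --> 0.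
Proof.
move=> p0 p_nearest; have poo : (Reg p < +oo)%E by rewrite p0.
have cauchy := path_cauchy p0.
have [|l ul] := complete (u := fun k => U k.+1%:R).
  move=> e /cauchy[a0 a00 h]; exists (Num.truncn a0) => m k Km Kk.
  have big i : (Num.truncn a0 <= i)%N -> a0 <= i.+1%:R.
    move=> Ki; apply: (le_trans (ltW (truncnS_gt a0))).
    by rewrite ler_nat ltnS.
  by apply: h; exact: big.
have Ul : q (U a - l) @[a --> +oo] --> 0.
  apply: sqn_cvg0 => e e0.
  have [|a0 a00 h] := cauchy (e / 4); first by lra.
  have ulk : \forall k \near \oo, q (U k.+1%:R - l) < e / 4.
    by apply: (cvgr_lt _ ul); lra.
  have bigk : \forall k \near \oo, a0 <= k.+1%:R.
    exists (Num.truncn a0) => // i /= Ki; apply: (le_trans (ltW (truncnS_gt a0))).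
    by rewrite ler_nat ltnS.
  have [k [kl ka]] := filter_ex (filterI ulk bigk).
  near=> a.
  have a0a : a0 <= a by near: a; exact: (nbhs_pinfty_ge (num_real _)).
  have := h _ _ a0a ka; have := sqn_le_double ip (U a) (U k.+1%:R) l; lra.
have loo : (Reg l <= 0)%E.
  apply: (@sqn_lsc_le _ _ ip _ +oo _ Reg U l (fun a => q (p - eta) / a)) => //.
    rewrite -[X in _ --> X](mulr0 (q (p - eta))); apply: cvgM; first exact: cvg_cst.
    apply/(@gtr0_cvgV0 _ _ (pinfty_nbhs R) _ id); last exact: cvg_id.
    exact: (nbhs_pinfty_gt (num_real _)).
  near=> a; have a0 : 0 < a by near: a; exact: (nbhs_pinfty_gt (num_real _)).
  rewrite -(regE (path_fin a0)) lee_fin.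
  by have := path_reg_le a0 poo; rewrite p0/= add0r.
have l0 : (Reg l = 0)%E by apply/eqP; rewrite eq_le loo Reg_ge0.
have lp : q (l - eta) <= q (p - eta).
  rewrite leNgt; apply/negP => lt_pl.
  have Ueta : q (U a - eta) @[a --> +oo] --> q (l - eta) by exact: sqn_cvg Ul.
  have near_lt : \forall a \near +oo, q (p - eta) < q (U a - eta).
    exact: cvgr_gt Ueta _ lt_pl.
  have [a [pa a0]] := filter_ex (filterI near_lt (nbhs_pinfty_gt (num_real (0 : R)))).
  have := min_strong a0 (U_min a0) poo; have := mulr_ge0 (ltW a0) (reg_ge0 (U a)).
  rewrite p0/=; have := sqn_ge0 ip (p - U a); lra.
have qlp : q (l - p) = 0.
  have [||moo mle] := @reg_convex (1/2) l p _ _ poo.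
  - by apply/andP; split; lra.
  - by rewrite l0.
  have m0 : (Reg ((1/2) *: l + (1 - 1/2) *: p) = 0)%E.
    rewrite -(regE moo); apply/eqP; rewrite eqe eq_le reg_ge0 andbT.
    by move: mle; rewrite l0 p0/=; lra.
  have := p_nearest _ m0; rewrite sqn_convex => le.
  by apply/eqP; rewrite eq_le sqn_ge0 andbT; lra.
by rewrite -qlp; exact: sqn_cvg Ul.
Unshelve. all: by end_near. Qed.

End path.
End finite_point.
End tikhonov.

(** * The optimal parameter *)

Section scalar_lemmas.
Context (R : realType).

(** Lower semicontinuity is inherited by sums. When one term of the limit is
    infinite, that term alone exceeds the bound, since the others are nonnegative. *)
Lemma adde_near_gt (T : Type) (F : set_system T) {FF : Filter F}
    (x y : \bar R) (f g : T -> \bar R) :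
  (0 <= x)%E -> (0 <= y)%E -> (forall t, 0 <= f t)%E -> (forall t, 0 <= g t)%E ->
  (forall b : R, (b%:E < x)%E -> \forall t \near F, (b%:E < f t)%E) ->
  (forall b : R, (b%:E < y)%E -> \forall t \near F, (b%:E < g t)%E) ->
  forall b : R, (b%:E < x + y)%E -> \forall t \near F, (b%:E < f t + g t)%E.
Proof.
move=> x0 y0 f0 g0 xf yg b.
have [xoo|xfin] := eqVneq x +oo%E.
  move=> _; have := xf b; rewrite xoo ltry => /(_ isT).
  by apply: filterS => t /lt_le_trans; apply; rewrite leeDl.
have [yoo|yfin] := eqVneq y +oo%E.
  move=> _; have := yg b; rewrite yoo ltry => /(_ isT).
  by apply: filterS => t /lt_le_trans; apply; rewrite leeDr.
have {}xfin : x \is a fin_num by rewrite ge0_fin_numE// ltey.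
have {}yfin : y \is a fin_num by rewrite ge0_fin_numE// ltey.
rewrite -(fineK xfin) -(fineK yfin) -EFinD lte_fin => bxy.
pose e := (fine x + fine y - b) / 2.
have xe : ((fine x - e)%:E < x)%E by rewrite -[ltRHS](fineK xfin) lte_fin /e; lra.
have ye : ((fine y - e)%:E < y)%E by rewrite -[ltRHS](fineK yfin) lte_fin /e; lra.
apply: filterS (filterI (xf _ xe) (yg _ ye)) => t [ft gt].
have -> : b = (fine x - e) + (fine y - e) by rewrite /e; lra.
by rewrite EFinD lteD.
Qed.

Lemma sume_near_gt (T : Type) (F : set_system T) {FF : Filter F} (N : nat)
    (x : 'I_N -> \bar R) (f : 'I_N -> T -> \bar R) :
  (forall j, 0 <= x j)%E -> (forall j t, 0 <= f j t)%E ->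
  (forall j (b : R), (b%:E < x j)%E -> \forall t \near F, (b%:E < f j t)%E) ->
  forall b : R, (b%:E < \sum_(j < N) x j)%E ->
    \forall t \near F, (b%:E < \sum_(j < N) f j t)%E.
Proof.
elim: N x f => [|N IH] x f x0 f0 xf b.
  rewrite big_ord0 => b0; apply: filterS (@filterT _ F _) => t _.
  by rewrite big_ord0.
under eq_near do rewrite big_ord_recr/=.
rewrite big_ord_recr/=; apply: adde_near_gt => //.
- exact: sume_ge0.
- by move=> t; exact: sume_ge0.
- by apply: IH => // j; exact: xf.
- exact: xf.
Qed.

(** Near 0 and near infinity [f] exceeds its value at [a1], so only a compact
    interval around [a1] matters. *)
Lemma exists_min_pos (f : R -> R) (l0 loo a1 : R) :
  (forall a : R, 0 < a -> f b @[b --> a] --> f a) ->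
  f a @[a --> 0^'+] --> l0 -> f a @[a --> +oo] --> loo ->
  0 < a1 -> f a1 < l0 -> f a1 < loo ->
  exists2 abar, 0 < abar & forall a, 0 < a -> f abar <= f a.
Proof.
move=> fc f0 foo a10 a1l0 a1loo.
have [d /= d0 hd] : \forall a \near 0^'+, f a1 < f a by apply: cvgr_gt f0 _ a1l0.
have [M [_ hM]] : \forall a \near +oo, f a1 < f a by apply: cvgr_gt foo _ a1loo.
pose a := Num.min a1 (d / 2); pose b := Num.max a1 (M + 1).
have a_gt0 : 0 < a by rewrite lt_min a10 divr_gt0.
have aa1 : a <= a1 by rewrite ge_min lexx.
have a1b : a1 <= b by rewrite le_max lexx.
have [||c /[!in_itv]/= /andP[ac cb] hc] := @EVT_min R f a b.
- exact: le_trans aa1 a1b.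
- apply: continuous_in_subspaceT => x; rewrite inE/= in_itv/= => /andP[ax _].
  by apply: fc; exact: lt_le_trans ax.
exists c => [|x x0]; first exact: lt_le_trans ac.
have ca1 : f c <= f a1 by apply: hc; rewrite in_itv/= aa1.
have [xa|ax] := ltP x a.
  apply: (le_trans ca1); apply/ltW/hd => //=.
  rewrite sub0r normrN gtr0_norm//; apply: (lt_trans xa).
  by rewrite gt_min; apply/orP; right; lra.
have [xb|bx] := leP x b; first by apply: hc; rewrite in_itv/= ax.
apply: (le_trans ca1); apply/ltW/hM; apply: le_lt_trans bx.
by rewrite le_max; apply/orP; right; lra.
Qed.

End scalar_lemmas.

Section parameter_choice.
Context (R : realType) (H : lmodType R) (ip : semi_inner H).
Local Notation q := (sqn ip).
Context (Reg : H -> \bar R).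
Hypothesis Reg_ge0 : forall u, (0 <= Reg u)%E.
Hypothesis Reg_convex : econvex Reg.
Hypothesis Reg_lsc : sqn_lsc ip Reg.
Hypothesis complete : sqn_complete ip.
Hypothesis dense_dom : forall u (e : R), 0 < e ->
  exists2 v, (Reg v < +oo)%E & q (v - u) < e.

(** The hypothesis on [Reg] makes the limit of the cost at 0 larger than some
    value of the cost, and the hypothesis on distances makes the limit at infinity
    larger still. *)
Theorem exists_optimal_parameter (N : nat) (uc ueta p : 'I_N -> H)
    (U : 'I_N -> R -> H) :
  (forall j (a : R), 0 < a -> tikhonov_min ip Reg (ueta j) a (U j a)) ->
  (forall j, Reg (p j) = 0%E) ->
  (forall j v, Reg v = 0%E -> q (p j - ueta j) <= q (v - ueta j)) ->
  (\sum_(j < N) Reg (uc j) < \sum_(j < N) Reg (ueta j))%E ->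
  \sum_(j < N) q (ueta j - uc j) < \sum_(j < N) q (p j - uc j) ->
  exists2 abar : R, 0 < abar & forall a, 0 < a ->
    \sum_(j < N) q (U j abar - uc j) <= \sum_(j < N) q (U j a - uc j).
Proof.
move=> U_min p0 p_nearest ltReg ltnorm.
have [v0 v0_fin _] := dense_dom 0 ltr01.
pose I a := \sum_(j < N) q (U j a - uc j).
have cvgI (F : set_system R) (FF : ProperFilter F) (l : 'I_N -> H) :
    (forall j, q (U j a - l j) @[a --> F] --> 0) ->
    I a @[a --> F] --> \sum_(j < N) q (l j - uc j).
  by move=> Ul; apply: cvg_big => [|j _]; [exact: add_continuous|exact: sqn_cvg].
have I0 : I a @[a --> 0^'+] --> \sum_(j < N) q (ueta j - uc j).
  apply: cvgI => j; apply: (path_cvg_at0 Reg_ge0 Reg_convex v0_fin (U_min j)).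
  exact: dense_dom.
have uc_fin j : (Reg (uc j) < +oo)%E.
  have : (\sum_(j < N) Reg (uc j) < +oo)%E by rewrite (lt_le_trans ltReg)// leey.
  by apply: le_lt_trans; rewrite (bigD1 j)//= leeDl// sume_ge0.
have [a1 a10 Ia1] : exists2 a1 : R, 0 < a1 & I a1 < \sum_(j < N) q (ueta j - uc j).
  (* Lower semicontinuity: near 0 the reconstructions are still less regular,
     in total, than uc. *)
  have : \forall a \near 0^'+,
      ((\sum_(j < N) fine (Reg (uc j)))%:E < \sum_(j < N) Reg (U j a))%E.
    apply: (sume_near_gt (x := fun j => Reg (ueta j))) => // [j b|].
      move=> /Reg_lsc[e e0 he].
      have := path_cvg_at0 Reg_ge0 Reg_convex v0_fin (U_min j) (dense_dom _).
      by move=> /cvgr_lt /(_ _ e0); apply: filterS => a; exact: he.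
    rewrite -sumEFin; under eq_bigr do rewrite regE//.
    exact: ltReg.
  move=> /(filterI (nbhs_right_gt (0 : R))) /filter_ex[a [a0 lta]].
  exists a => //.
  have Ufin j := path_fin Reg_ge0 v0_fin (U_min j) a0.
  have : \sum_(j < N) fine (Reg (uc j)) < \sum_(j < N) fine (Reg (U j a)).
    by rewrite -lte_fin -[ltRHS]sumEFin; under [ltRHS]eq_bigr do rewrite regE//.
  rewrite -(ltr_pM2l a0) => lt_reg.
  have : \sum_(j < N) (a * fine (Reg (U j a)) + q (U j a - uc j)) <=
      \sum_(j < N) (q (ueta j - uc j) + a * fine (Reg (uc j))).
    apply: ler_sum => j _.
    have := min_strong Reg_ge0 Reg_convex v0_fin a0 (U_min j a a0) (uc_fin j).
    rewrite (sqnBC _ (uc j) (U j a)) (sqnBC _ (uc j)).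
    have := sqn_ge0 ip (U j a - ueta j); lra.
  rewrite !big_split/= -!mulr_sumr => le.
  rewrite /I; lra.
apply: (@exists_min_pos R I _ _ a1 _ I0 _ a10 Ia1 (lt_trans Ia1 ltnorm)).
  move=> a a0; apply: (@cvgI (nbhs a)) => j.
  exact: (path_continuous Reg_ge0 Reg_convex v0_fin (U_min j)).
apply: cvgI => j.
exact: (path_cvg_pinfty Reg_ge0 Reg_convex v0_fin Reg_lsc complete (U_min j)
  (p0 j) (p_nearest j)).
Qed.

End parameter_choice.

(** * L^2 as a complete semi-inner product space *)

Section L2_inner.
Context d (T : measurableType d) (R : realType) (mu : {measure set T -> \bar R}).
Local Notation E := (LfunType mu (lee1n 2)).

Lemma L2_mul_integrable (u v : E) :
  mu.-integrable setT (EFin \o (fun x => u x * v x)).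
Proof. by apply/Lfun1_integrable/Lfun2_mul_Lfun1; exact: LfunP. Qed.

Definition L2_inner_fun (u v : E) : R := (\int[mu]_x (u x * v x))%R.

Lemma L2_innerC u v : L2_inner_fun u v = L2_inner_fun v u.
Proof. by apply: eq_Rintegral => x _; rewrite mulrC. Qed.

Lemma L2_innerDl u v w :
  L2_inner_fun (u + v) w = L2_inner_fun u w + L2_inner_fun v w.
Proof.
rewrite /L2_inner_fun -RintegralD//; try exact: L2_mul_integrable.
by apply: eq_Rintegral => x _; rewrite -mulrDl.
Qed.

Lemma L2_innerZl a u v : L2_inner_fun (a *: u) v = a * L2_inner_fun u v.
Proof.
rewrite /L2_inner_fun -RintegralZl//; last exact: L2_mul_integrable.
by apply: eq_Rintegral => x _; rewrite mulrA.
Qed.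

Lemma L2_inner_ge0 u : 0 <= L2_inner_fun u u.
Proof. by apply: Rintegral_ge0 => x _; rewrite -expr2 sqr_ge0. Qed.

Definition L2_inner : semi_inner E :=
  SemiInner L2_innerC L2_innerDl L2_innerZl L2_inner_ge0.

Local Notation q := (sqn L2_inner).

Lemma L2_sqnE (u : E) : ((q u)%:E = \int[mu]_x (u x ^+ 2)%:E)%E.
Proof.
have := L2_mul_integrable u u => iu.
rewrite /sqn/= /L2_inner_fun /Rintegral fineK; last exact: integrable_fin_num.
by apply: eq_integral => x _; rewrite expr2.
Qed.

Lemma Lnorm_sqn (u : E) : ('N[mu]_2%:E[EFin \o u] ^+ 2 = (q u)%:E)%E.
Proof.
have h : ((fine 'N[mu]_2%:E[EFin \o u] ^+ 2)%:E =
    \int[mu]_x (`|u x| `^ 2)%:E)%E.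
  rewrite -powR_mulrn ?fine_ge0 ?Lnorm_ge0// -poweR_EFin finite_norm_fine.
  by rewrite powR_Lnorm// pnatr_eq0.
rewrite -finite_norm_fine -EFin_expe h L2_sqnE.
by apply: eq_integral => x _ /=; rewrite powR_mulrn// -normrX ger0_norm ?sqr_ge0.
Qed.

Lemma L2_in (f : T -> R) : measurable_fun setT f ->
  (\int[mu]_x (f x ^+ 2)%:E < +oo)%E -> exists u : E, u = f :> (T -> R).
Proof.
move=> mf foo.
suff Pf : f \in Lfun mu 2%:E by exists (Lfun_Sub (lee1n 2) Pf).
apply/andP; split; rewrite inE//= /finite_norm.
apply: (@lty_poweRy _ _ 2) => //.
rewrite powR_Lnorm//; move: foo; congr (_ < _)%E.
by apply: eq_integral => x _ /=; rewrite powR_mulrn// -normrX ger0_norm ?sqr_ge0.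
Qed.

Lemma Lp_ballE (u v : E) (e : R) : 0 < e ->
  Lp_ball u e v <-> q (v - u) < e ^+ 2.
Proof.
move=> e0; rewrite /Lp_ball /mkset -finite_norm_fine lte_fin sqnBC.
have := Lnorm_sqn (u - v); rewrite -finite_norm_fine -EFin_expe => h.
rewrite -(EFin_inj h).
by rewrite ltr_pXn2r ?nnegrE ?fine_ge0 ?Lnorm_ge0 ?ltW.
Qed.

End L2_inner.

Section L2_complete.
Context d (T : measurableType d) (R : realType) (mu : {measure set T -> \bar R}).
Local Notation E := (LfunType mu (lee1n 2)).
Local Notation q := (sqn (L2_inner mu)).

Lemma limn_einf_ub (h : (\bar R)^nat) (c : \bar R) :
  (forall m, (h m <= c)%E) -> (limn_einf h <= c)%E.
Proof.
move=> hc; rewrite limn_einf_lim; apply: lime_le; first exact: is_cvg_einfs.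
apply: nearW => m; apply: le_trans (hc m).
by apply: ereal_inf_lbound; exists m => //=.
Qed.

(** Fatou's lemma, applied to [(v m - z) ^+ 2]: a bound on distances survives
    almost everywhere convergence. *)
Lemma L2_fatou (v : nat -> E) (z : E) (w : T -> R) (c : R) :
  measurable_fun setT w ->
  {ae mu, forall x, v m x @[m --> \oo] --> w x} ->
  (forall m, q (v m - z) <= c) ->
  (\int[mu]_x ((w x - z x) ^+ 2)%:E <= c%:E)%E.
Proof.
move=> mw vw vc.
pose h m x := ((v m x - z x) ^+ 2)%:E.
have mh m : measurable_fun setT (h m).
  by apply/measurable_EFinP/measurable_funX; exact: measurable_funB.
have mwz : measurable_fun setT (fun x => ((w x - z x) ^+ 2)%:E).
  by apply/measurable_EFinP/measurable_funX; exact: measurable_funB.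
have -> : (\int[mu]_x ((w x - z x) ^+ 2)%:E = \int[mu]_x limn_einf (h ^~ x))%E.
  have mliminf : measurable_fun setT (fun x => limn_einf (h ^~ x)).
    rewrite (_ : (fun x => _) = (fun x => - limn_esup (fun m => - h m x))%E).
      apply: measurableT_comp => //; apply: measurable_fun_limn_esup => m.
      exact: measurableT_comp.
    by apply/funext => x; rewrite (limn_esupN (h ^~ x)) oppeK.
  apply: ae_eq_integral => //.
  apply: filterS vw => x vx _; apply/esym.
  have hx : h m x @[m --> \oo] --> ((w x - z x) ^+ 2)%:E.
    apply: cvg_EFin; first exact: nearW.
    have vz : v m x - z x @[m --> \oo] --> w x - z x.
      by apply: cvgB => //; exact: cvg_cst.
    by rewrite expr2; exact: (cvgM vz vz).
  by rewrite (cvg_limn_einf_sup hx).1.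
apply: le_trans (fatou _ _ _ _) _ => //.
  by move=> m x _; rewrite lee_fin sqr_ge0.
apply: limn_einf_ub => m.
by rewrite -(L2_sqnE (v m - z)) lee_fin.
Qed.

(** The weighted sum of [2 ^+ k * (v k.+1 x - v k x) ^+ 2] has a finite integral,
    since its terms have integrals at most [2 ^- k]; hence it is finite for almost
    every [x]. For such [x] the increments are absolutely summable, because
    [`|y| <= 2 ^- k + 2 ^+ k * y ^+ 2] for every real [y]. *)
Lemma ae_cvg_rapid (v : nat -> E) :
  (forall k, q (v k.+1 - v k) <= (4^-1) ^+ k) ->
  {ae mu, forall x, cvgn (v ^~ x)}.
Proof.
move=> vq.
pose D k x := 2 ^+ k * (v k.+1 x - v k x) ^+ 2.
have D0 k x : 0 <= D k x by apply: mulr_ge0; [exact: exprn_ge0|exact: sqr_ge0].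
have mD k : measurable_fun setT (fun x => (D k x)%:E).
  apply/measurable_EFinP; apply: measurable_funM => //.
  by apply/measurable_funX; exact: measurable_funB.
pose g x := (\sum_(k <oo) (D k x)%:E)%E.
have g0 x : (0 <= g x)%E by apply: nneseries_ge0 => k _ _; rewrite lee_fin.
have mg : measurable_fun setT g.
  by apply: ge0_emeasurable_sum => // k x _ _; rewrite lee_fin.
have intD k : (\int[mu]_x (D k x)%:E <= (2^-1 ^+ k)%:E)%E.
  rewrite /D; under eq_integral do rewrite EFinM.
  rewrite ge0_integralZl//=; last 2 first.
  - by apply/measurable_EFinP/measurable_funX; exact: measurable_funB.
  - by move=> x _; rewrite lee_fin sqr_ge0.
  rewrite -(L2_sqnE (v k.+1 - v k)) -EFinM lee_fin.
  apply: (le_trans (ler_wpM2l _ (vq k))); first by rewrite exprn_ge0.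
  by rewrite -exprMn; have -> : 2 * 4^-1 = 2^-1 :> R by lra.
have intg : (\int[mu]_x g x < +oo)%E.
  rewrite integral_nneseries//; last by move=> k x _; rewrite lee_fin.
  apply: (@le_lt_trans _ _ 2%:E); last exact: ltry.
  apply: (@le_trans _ _ (\sum_(k <oo) (2^-1 ^+ k)%:E)%E).
    by apply: lee_nneseries => // k _ _; apply: integral_ge0 => x _; rewrite lee_fin.
  rewrite (@eq_eseriesr _ _ (fun k => (2 / (2 ^ k.+1)%N%:R)%:E)); last first.
    move=> k _; congr EFin.
    by rewrite natrX exprVn exprS invfM mulrA divff// mul1r.
  by apply: epsilon_trick0; lra.
have gfin : {ae mu, forall x, g x \is a fin_num}.
  have : mu.-integrable setT g.
    apply/integrableP; split => //.
    by under eq_integral do rewrite gee0_abs//.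
  by move=> /(integrable_ae measurableT); apply: filterS => x /(_ I).
apply: filterS gfin => x gx.
have cD : cvgn (series (D ^~ x)).
  by apply: nnseries_is_cvg => //; rewrite -(ge0_fin_numE (g0 x)).
have c2 : cvgn (series (geometric 1 (2^-1 : R))).
  by apply: is_cvg_geometric_series; rewrite ger0_norm; lra.
have cd : cvgn (series (telescope (v ^~ x))).
  apply: normed_cvg; apply: series_le_cvg (is_cvg_seriesD c2 cD) => k.
  - exact: normr_ge0.
  - by apply: addr_ge0 => //; rewrite /geometric /= mul1r exprn_ge0.
  rewrite /telescope fctE /geometric /= mul1r /D exprVn; move: (v k.+1 x - v k x) => y.
  have p0 : 0 < 2 ^+ k :> R by rewrite exprn_gt0.
  move: p0; move: (2 ^+ k) => P p0.
  rewrite -(ler_pM2l p0) mulrDr divff ?gt_eqF//.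
  have := sqr_ge0 (P * `|y| - 1/2); rewrite -(real_normK (num_real y)).
  lra.
have -> : v ^~ x = (fun n => v 0%N x + series (telescope (v ^~ x)) n).
  by apply/funext => n; exact: (eq_sum_telescope (v ^~ x)).
by apply: is_cvgD => //; exact: is_cvg_cst.
Qed.

(** Riesz-Fischer: a rapidly converging subsequence has an almost everywhere limit
    [w], and Fatou's lemma turns the Cauchy condition into convergence to [w]. *)
Theorem L2_complete : sqn_complete (L2_inner mu).
Proof.
move=> u cauchy_u.
have /choice[K hK] : forall k : nat, exists K, forall i j, (K <= i)%N -> (K <= j)%N ->
    q (u i - u j) < 4^-1 ^+ k.
  by move=> k; apply: cauchy_u; rewrite exprn_gt0.
(* Partial sums make the ranks nondecreasing and unbounded. *)
pose n k := (\sum_(i < k.+1) (K i).+1)%N.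
have nS k : n k.+1 = (n k + (K k.+1).+1)%N by rewrite /n big_ord_recr.
have nK k : (K k <= n k)%N by rewrite /n big_ord_recr/= ltnW// leq_addl.
have nk k : (k <= n k)%N.
  elim: k => // k IH; rewrite nS -addn1; exact: leq_add.
pose v k := u (n k).
have vq k : q (v k.+1 - v k) <= 4^-1 ^+ k.
  by apply/ltW/hK; rewrite ?nS; [exact: leq_trans (nK k) (leq_addr _ _)|exact: nK].
(* The upper limit is measurable and finite wherever v converges. *)
pose w x := fine (limn_esup (fun m => (v m x)%:E)).
have mw : measurable_fun setT w.
  apply: measurableT_comp => //; apply: measurable_fun_limn_esup => m.
  exact/measurable_EFinP.
have vw : {ae mu, forall x, v m x @[m --> \oo] --> w x}.
  apply: filterS (ae_cvg_rapid vq) => x /cvg_ex[/= l vl].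
  have vlE : (v m x)%:E @[m --> \oo] --> l%:E.
    by apply: cvg_EFin => //; exact: nearW.
  by rewrite /w (cvg_limn_einf_sup vlE).2.
have close (e : R) : 0 < e -> exists K, forall k, (K <= k)%N ->
    (\int[mu]_x ((w x - u k x) ^+ 2)%:E <= e%:E)%E.
  move=> /cauchy_u[L hL]; exists L => k Lk.
  apply: (@L2_fatou (fun m => v (m + L)%N)) => //.
    by apply: filterS vw => x vx; rewrite (cvg_shiftn L (v ^~ x)).
  move=> m; apply/ltW/hL => //.
  exact: leq_trans (leq_addl m L) (nk _).
(* w is not known to be square-integrable, but its difference to u L is. *)
have [L hL] := close 1 ltr01.
have [||z zE] := @L2_in _ _ _ mu (fun x => w x - u L x).
- exact: measurable_funB.
- exact: le_lt_trans (hL L (leqnn L)) (ltry _).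
exists (z + u L); apply: sqn_cvg0 => e e0.
have [|M hM] := close (e / 2); first by rewrite divr_gt0.
exists M => // k Mk; change (q (u k - (z + u L)) < e); rewrite sqnBC.
suff : q (z + u L - u k) <= e / 2 by lra.
rewrite -lee_fin L2_sqnE; apply: le_trans (hM k Mk).
rewrite le_eqVlt; apply/orP; left; apply/eqP; apply: eq_integral => x _.
have -> : (z + u L - u k : E) x = z x + u L x - u k x by [].
by rewrite zE subrK.
Qed.

End L2_complete.

(** * The topology, the constants and the mean *)

Section L2_topology.
Context d (T : measurableType d) (R : realType) (mu : {measure set T -> \bar R}).
Local Notation E := (LfunType mu (lee1n 2)).
Local Notation q := (sqn (L2_inner mu)).

Lemma lower_semicontinuous_sqn (f : E -> \bar R) :
  lower_semicontinuous f -> sqn_lsc (L2_inner mu) f.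
Proof.
move=> flsc u b /flsc[V /nbhs_ballP[e /= e0 eV] bV].
exists (e ^+ 2) => [|v uv]; first exact: exprn_gt0.
by apply/bV/eV/Lp_ballE.
Qed.

Lemma dense_sqn (S : set E) : dense S -> forall u (e : R), 0 < e ->
  exists2 v, S v & q (v - u) < e.
Proof.
move=> dS u e e0; have s0 : 0 < Num.sqrt e by rewrite sqrtr_gt0.
have [|v [uv Sv]] := dS (ball u (Num.sqrt e))° _ (@open_interior _ _).
  by exists u; apply: nbhsx_ballx.
exists v => //; rewrite -[e]sqr_sqrtr ?ltW//; apply/Lp_ballE => //.
exact: interior_subset uv.
Qed.

Lemma L2_sqn_ae (u v : E) : u = v %[ae mu] -> q (u - v) = 0.
Proof.
move=> uv; apply: EFin_inj; rewrite L2_sqnE.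
rewrite -[RHS](integral0 mu setT); apply: ae_eq_integral => //.
  by apply/measurable_EFinP/measurable_funX.
apply: filterS uv => x uvx _.
have -> : (u - v : E) x = u x - v x by [].
by rewrite uvx// subrr expr0n.
Qed.

Lemma L2_cst : (mu setT < +oo)%E -> exists one : E, one = cst 1 :> (T -> R).
Proof.
move=> muT; apply: L2_in => //.
by under eq_integral do rewrite expr1n; rewrite integral_cst// mul1e.
Qed.

End L2_topology.

(** The complement of [D] is null for the restricted measure, and inside [D] the
    two measures agree. *)
Lemma integral_mrestr d (T : measurableType d) (R : realType)
    (mu : {measure set T -> \bar R}) (D : set T) (mD : measurable D)
    (f : T -> \bar R) :
  (mrestr mu mD).-integrable setT f ->
  (\int[mrestr mu mD]_x f x = \int[mu]_(x in D) f x)%E.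
Proof.
move=> intf; have D0 : mrestr mu mD (~` D) = 0%E.
  by rewrite /mrestr setICl measure0.
rewrite (negligible_integral (measurableC mD) measurableT intf D0).
rewrite setTD setCK; apply: eq_measure_integral => A mA AD.
by rewrite /= /mrestr setIidl.
Qed.

(** * The minimization problem *)

Local Open Scope ereal_scope.

Lemma argmin_KP (R : realType) (n : nat) (Omega : set 'rV[R]_n)
    (oOmega : open Omega) (N : nat) (Reg : L2 oOmega -> \bar R)
    (ueta : 'I_N -> L2 oOmega) (a : R) (j : 'I_N) (u : L2 oOmega) :
  argmin_K Reg ueta a j u <->
  tikhonov_min (L2_inner (lebesgue_on oOmega)) Reg (ueta j) a u.
Proof.
have JE v : functional_J Reg ueta a j v =
    tikhonov (L2_inner (lebesgue_on oOmega)) Reg (ueta j) a v.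
  by rewrite /functional_J /normL2sq Lnorm_sqn.
by split=> umin v; have := umin v; rewrite !JE.
Qed.

Lemma normL2sqvE (R : realType) (n : nat) (Omega : set 'rV[R]_n)
    (oOmega : open Omega) (N : nat) (u : 'I_N -> L2 oOmega) :
  normL2sqv oOmega u =
  (\sum_(j < N) sqn (L2_inner (lebesgue_on oOmega)) (u j))%R%:E.
Proof.
by rewrite /normL2sqv -sumEFin; apply: eq_bigr => j _; rewrite -Lnorm_sqn.
Qed.

Theorem theorem3p2 (R : realType) (n : nat) (Omega : set 'rV[R]_n)
    (oOmega : open Omega) (bOmega : bounded_set Omega)
    (N : nat) (uc ueta : 'I_N -> L2 oOmega) (Reg : L2 oOmega -> \bar R)
    (Reg_ae : forall u v : L2 oOmega,
      u = v %[ae lebesgue_on oOmega] -> Reg u = Reg v)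
    (Reg_ge0 : forall u, 0 <= Reg u)
    (Reg_convex : econvex Reg)
    (Reg_lsc : lower_semicontinuous Reg)
    (Reg_cst : forall u : L2 oOmega, Reg u = 0 <->
      exists c : R, u = cst c %[ae lebesgue_on oOmega])
    (Reg_dense : dense [set u : L2 oOmega | Reg u < +oo])
    (ltReg : \sum_(j < N) Reg (uc j) < \sum_(j < N) Reg (ueta j))
    (ltnorm : normL2sqv oOmega (fun j => ueta j - uc j)%R <
      normL2sqv oOmega (fun j x => mean Omega (ueta j) - uc j x)%R) :
  (forall a : R, (0 < a)%R -> 0 <= cost_I Reg uc ueta a < +oo) /\
  exists2 abar : R, (0 < abar)%R &
    forall a : R, (0 < a)%R -> cost_I Reg uc ueta abar <= cost_I Reg uc ueta a.
Proof.
pose mu := lebesgue_on oOmega; pose ip := L2_inner mu.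
have mOmega := measurable_open_rV oOmega.
have Reg_lscq := lower_semicontinuous_sqn Reg_lsc.
have dense_dom := dense_sqn Reg_dense.
have complete := @L2_complete _ _ R mu.
have [v0 v0_fin _] := dense_dom 0%R 1%R ltr01.
have muE : mu setT = lebesgue_rV R n Omega by rewrite /mu /= /mrestr setTI.
have muT : mu setT < +oo by rewrite muE lebesgue_rV_bounded.
have [one oneE] := L2_cst muT.
have ip_one f : ip one f = (\int[lebesgue_rV R n]_(x in Omega) f x)%R.
  rewrite /ip /= /L2_inner_fun /Rintegral.
  have := @L2_mul_integrable _ _ _ mu one f => /integral_mrestr ->.
  by apply: congr1; apply: eq_integral => x _; rewrite /= oneE /= mul1r.
have meanE (f : L2 oOmega) : mean Omega f = (ip one f / sqn ip one)%R.
  rewrite /mean -ip_one; congr (_ / _)%R; rewrite /sqn ip_one.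
  by rewrite oneE Rintegral_cst// mul1r.
(* The mean, as a constant function, is the projection onto the line of one. *)
pose p j : L2 oOmega := (mean Omega (ueta j) *: one)%R.
have scale_one (c : R) x : (c *: one : L2 oOmega)%R x = c.
  by rewrite -[LHS]/(c * one x)%R oneE mulr1.
have Reg0 (c : R) : Reg (c *: one)%R = 0.
  by apply/Reg_cst; exists c; apply/nearW => x _; rewrite scale_one.
have p_nearest j v : Reg v = 0 ->
    (sqn ip (p j - ueta j) <= sqn ip (v - ueta j))%R.
  move=> /Reg_cst[c vc].
  rewrite (@sqn_eq0_dist _ _ ip v (c *: one)%R).
    by rewrite /p meanE; exact: line_projection.
  apply: L2_sqn_ae; apply: filterS vc => x vxc /vxc ->.
  by rewrite scale_one.
have /choice[U hU] : forall j, exists Uj : R -> L2 oOmega,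
    forall a : R, (0 < a)%R -> tikhonov_min ip Reg (ueta j) a (Uj a).
  move=> j; have /choice[Uj hUj] : forall a : R, exists u,
      (0 < a)%R -> tikhonov_min ip Reg (ueta j) a u.
    move=> a; have [a0|_] := ltP 0%R a; last by exists 0%R.
    by have [u hu] := min_exists Reg_ge0 Reg_convex v0_fin Reg_lscq complete
      (ueta j) a0; exists u.
  by exists Uj.
have cost_IE (a : R) : (0 < a)%R ->
    cost_I Reg uc ueta a = (\sum_(j < N) sqn ip (U j a - uc j))%R%:E.
  move=> a0; rewrite /cost_I -[RHS]ereal_inf1; congr ereal_inf.
  apply/seteqP; split => [_ [w /= wK <-]|_ ->].
    rewrite /= (normL2sqvE (fun j => w j - uc j)%R); congr EFin.
    apply: eq_bigr => j _.
    apply: sqn_eq0_dist; have /argmin_KP wmin := wK j.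
    exact: (min_unique Reg_ge0 Reg_convex v0_fin a0 wmin (hU j a a0)).
  exists (fun j => U j a) => [j /=|]; last exact: (normL2sqvE (fun j => U j a - uc j)%R).
  by apply/argmin_KP; exact: hU.
split=> [a a0|].
  rewrite cost_IE// ltry lee_fin andbT; apply: sumr_ge0 => j _; exact: sqn_ge0.
have [|abar abar0 hmin] := exists_optimal_parameter Reg_ge0 Reg_convex Reg_lscq
    complete dense_dom hU (fun j => Reg0 _) p_nearest ltReg.
  rewrite -lte_fin -(normL2sqvE (fun j => ueta j - uc j)%R).
  rewrite -(normL2sqvE (fun j => p j - uc j)%R); apply: (lt_le_trans ltnorm).
  rewrite le_eqVlt; apply/orP; left; apply/eqP; congr normL2sqv.
  apply/funext => j; apply/funext => x.
  by rewrite -[RHS]/(p j x - uc j x)%R scale_one.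
by exists abar => // a a0; rewrite !cost_IE// lee_fin; exact: hmin.
Qed.
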